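(* Let $\mu_1,\dots,\mu_k$ be Gaussian integers, let $b_1,\dots,b_k$ be rational integers (not necessarily distinct), let $p_1,\dots,p_t$ be rational primes with $p_n\equiv 3 \pmod 4$ for all $n$ (so each $p_n$ is also a Gaussian prime), and let $\pi_1,\dots,\pi_\ell$ be non-rational Gaussian primes. Suppose that all of $\mu_1,\dots,\mu_k,p_1,\dots,p_t,\pi_1,\dots,\pi_\ell$ are pairwise coprime in $\mathbb{Z}[i]$. Then there are infinitely many primitive Gaussian lines $L$ satisfying all of the following: (a) $\mu_1,\dots,\mu_k\in\mathcal{D}(L)$; (b) $p_1,\dots,p_t,\pi_1,\dots,\pi_\ell\notin\mathcal{D}(L)$; (c) $\mu_j$ divides the Gaussian integer $\alpha_{b_j}$ on $L$ for each $1\le j\le k$.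
   Context: A Gaussian line is a line in the complex plane containing at least two (hence infinitely many) Gaussian integers; it is primitive if it contains two Gaussian integers that are coprime in $\mathbb{Z}[i]$. For a Gaussian line $L$, let $\alpha_0$ be the Gaussian integer on $L$ of minimum norm $N(x+iy)=x^2+y^2$ (if there are two such, take the one with larger real part). If $L$ is vertical, set $\delta=i$; otherwise let $\alpha_1$ be the Gaussian integer on $L$ with $\mathrm{Re}(\alpha_1)>\mathrm{Re}(\alpha_0)$ that is closest to $\alpha_0$, and set $\delta=\alpha_1-\alpha_0$. Then the Gaussian integers on $L$ are exactly $\alpha_m=\alpha_0+m\delta$ for $m\in\mathbb{Z}$; this indexing is used throughout. The divisor set $\mathcal{D}(L)$ is the set of Gaussian integers that divide at least one Gaussian integer lying on $L$.
   Formalization: Added: every μ_j is nonzero (if μ_j=0 at most two lines qualify), and for distinct m, m′ the prime π_m is coprime to the conjugate of π_{m′} (for 2+i and 2−i no line satisfies (b)); the claim fails in all the excluded cases. *)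

(* Defs.v *)
From HB Require Import structures.
From mathcomp Require Import all_boot all_order all_algebra.
From mathcomp Require Import ring.
From mathcomp Require Import boolp classical_sets cardinality reals.
From mathcomp Require Import complex.

Set Implicit Arguments.
Unset Strict Implicit.
Unset Printing Implicit Defensive.

Import Order.TTheory GRing.Theory Num.Theory.
Import complex.
Local Open Scope classical_set_scope.
Local Open Scope ring_scope.
Local Open Scope complex_scope.

(* The library makes [R[i]] a ring only when [R] is a field, so the ring
   structure on Z[i] is built here from the library's own multiplication. *)
Definition gint : Type := int[i].

HB.instance Definition _ := GRing.Zmodule.on gint.

Lemma gint_mul1 : left_id (1 +i* 0 : gint) (@ComplexField.mulc int).
Proof. by move=> [a b] /=; rewrite !mul1r !mul0r subr0 addr0. Qed.

Lemma gint_mulDl :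
  left_distributive (@ComplexField.mulc int) (@ComplexField.addc int).
Proof. by move=> [a b] [c d] [e f] /=; congr (_ +i* _); ring. Qed.

Lemma gint_neq10 : (1 +i* 0 : gint) != 0.
Proof. by []. Qed.

HB.instance Definition _ := GRing.Zmodule_isComNzRing.Build gint
  (@ComplexField.mulcA int) (@ComplexField.mulcC int)
  gint_mul1 gint_mulDl gint_neq10.

Definition gnorm (z : gint) : int := Re z ^+ 2 + Im z ^+ 2.

Definition gdvd (a b : gint) : Prop := exists c : gint, b = c * a.

Definition gunit (u : gint) : Prop := gdvd u 1.

Definition gcoprime (a b : gint) : Prop :=
  forall d : gint, gdvd d a -> gdvd d b -> gunit d.

Definition gprime (q : gint) : Prop :=
  [/\ q <> 0, ~ gunit q &
      forall a b : gint, gdvd q (a * b) -> gdvd q a \/ gdvd q b].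

Section Lines.
Variable R : realType.
Implicit Types (L : set R[i]) (z : gint).

Definition gint_to_complex z : R[i] := (Re z)%:~R +i* (Im z)%:~R.

Definition is_line L : Prop :=
  exists a v : R[i], v <> 0 /\ L = [set a + t%:C * v | t in [set: R]].

Definition gpoints L : set gint := [set z | L (gint_to_complex z)].

Definition gaussian_line L : Prop :=
  is_line L /\ exists z w, [/\ gpoints L z, gpoints L w & z <> w].

Definition primitive_gaussian_line L : Prop :=
  gaussian_line L /\
  exists z w, [/\ gpoints L z, gpoints L w, z <> w & gcoprime z w].

Definition divisor_set L : set gint :=
  [set d | exists z, gpoints L z /\ gdvd d z].

Definition vertical L : Prop :=
  forall x y : R[i], L x -> L y -> Re x = Re y.

(* [a] is alpha_0. *)
Definition base_point L (a : gint) : Prop :=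
  gpoints L a /\
  forall z, gpoints L z ->
    gnorm a <= gnorm z /\ (gnorm z = gnorm a -> Re z <= Re a).

(* [a1] is alpha_1 for a non-vertical line with alpha_0 = [a0]; distances are
   compared through their squares. *)
Definition next_point L (a0 a1 : gint) : Prop :=
  [/\ gpoints L a1, Re a0 < Re a1 &
      forall z, gpoints L z -> Re a0 < Re z -> gnorm (a1 - a0) <= gnorm (z - a0)].

(* [d] is delta for a line with alpha_0 = [a0]. *)
Definition step L (a0 d : gint) : Prop :=
  (vertical L /\ d = 0 +i* 1) \/
  (~ vertical L /\ exists a1, next_point L a0 a1 /\ d = a1 - a0).

(* [z] is alpha_m; alpha_0 and delta are uniquely determined by a Gaussian
   line, so this relation is functional in [m]. *)
Definition indexed_point L (m : int) z : Prop :=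
  exists a0 d, [/\ base_point L a0, step L a0 d & z = a0 + d *~ m].

End Lines.

Definition join_family (k t l : nat) (mu : 'I_k -> gint) (p : 'I_t -> nat)
    (ppi : 'I_l -> gint) (x : 'I_k + 'I_t + 'I_l) : gint :=
  match x with
  | inl (inl j) => mu j
  | inl (inr n) => (p n)%:R
  | inr m => ppi m
  end.

(* Main.v *)
(* Let P be the product of those pi_m that no rational integer > 1 divides. Since
   the pi_m are pairwise coprime to each other's conjugates, P itself has no such
   divisor. The Chinese remainder theorem gives a <> 0 with a = - b_j P mod mu_j,
   a = i P mod p_n and mod the remaining pi_m, and a = 1 mod the factors of P.
   Take d = P modulo a multiple K of a and of all the given numbers, with coprime
   coordinates and Re d much larger than a. Then the line a + t d has alpha_0 = a
   and delta = d, contains the coprime points a and a + d, and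
   - mu_j divides a + b_j d;
   - a + m d = (i + m) P modulo p_n and modulo the remaining pi_m, and this is
     not 0;
   - a + m d = 1 modulo each factor of P. *)
Require Import Defs.
From mathcomp Require Import all_boot all_order all_algebra.
From mathcomp Require Import ring zify.
From mathcomp Require Import boolp classical_sets cardinality reals.
From mathcomp Require Import complex.

Import Order.TTheory GRing.Theory Num.Theory.
Import complex.
Local Open Scope classical_set_scope.
Local Open Scope ring_scope.
Local Open Scope complex_scope.

(* MathComp's [monoid] also defines a [gnorm], a multirule for group expressions. *)
Local Notation gnorm := Defs.gnorm.

(** * Conjugation, norm and divisibility in Z[i] *)

Definition gconj (x : gint) : gint := conjc x.

Lemma gintP (x y : gint) : Re x = Re y -> Im x = Im y -> x = y.
Proof. by case: x y => [a b] [c d] /= -> ->. Qed.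

Lemma gintE :
  ((forall x y : gint, Re (x + y) = Re x + Re y) *
   (forall x y : gint, Im (x + y) = Im x + Im y)) *
  ((forall x : gint, Re (- x) = - Re x) *
   (forall x : gint, Im (- x) = - Im x)) *
  ((forall x y : gint, Re (x * y) = Re x * Re y - Im x * Im y) *
   (forall x y : gint, Im (x * y) = Re x * Im y + Im x * Re y)) *
  ((Re (0 : gint) = 0) * (Im (0 : gint) = 0) *
   (Re (1 : gint) = 1) * (Im (1 : gint) = 0)) *
  ((forall x : gint, Re (gconj x) = Re x) *
   (forall x : gint, Im (gconj x) = - Im x)).
Proof. by do !split; do ?case=> a b; do ?case=> c d. Qed.

Lemma gint_natE (n : nat) : (n%:R : gint) = n%:Z +i* 0.
Proof.
elim: n => [|n IHn]; first by [].
by rewrite mulrS IHn; apply: gintP; rewrite !gintE /= ?addr0 // -intS.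
Qed.

Lemma gint_intE (n : int) : (n%:~R : gint) = n +i* 0.
Proof.
case: n => n; first exact: gint_natE.
by rewrite NegzE mulrNz -pmulrn gint_natE; apply: gintP; rewrite !gintE /= ?oppr0.
Qed.

Lemma Re_mulrz (z : gint) (m : int) : Re (z *~ m) = Re z * m.
Proof. by rewrite -mulrzr gint_intE gintE /= mulr0 subr0. Qed.

Lemma Im_mulrz (z : gint) (m : int) : Im (z *~ m) = Im z * m.
Proof. by rewrite -mulrzr gint_intE gintE /= mulr0 add0r. Qed.

Lemma gconjM (x y : gint) : gconj (x * y) = gconj x * gconj y .
Proof. by case: x y => [a b] [c d]; apply: gintP; rewrite !gintE /=; ring. Qed.

Lemma gconjD (x y : gint) : gconj (x + y) = gconj x + gconj y .
Proof. by case: x y => [a b] [c d]; apply: gintP; rewrite !gintE /=; ring. Qed.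

Lemma mul_gconj (x : gint) : x * gconj x = (gnorm x)%:~R.
Proof.
by rewrite gint_intE /gnorm; case: x => a b; apply: gintP; rewrite !gintE /=; ring.
Qed.

Lemma gnormM (x y : gint) : gnorm (x * y) = gnorm x * gnorm y.
Proof. by rewrite /gnorm !gintE; ring. Qed.

Lemma gnorm_ge0 (x : gint) : 0 <= gnorm x.
Proof. by rewrite addr_ge0 // sqr_ge0. Qed.

Lemma gnorm_eq0 (x : gint) : (gnorm x == 0) = (x == 0).
Proof.
rewrite paddr_eq0 ?sqr_ge0 // !sqrf_eq0.
by apply/andP/eqP => [[/eqP hr /eqP hi]|->]; first exact: gintP.
Qed.

Lemma gint_mulf_neq0 (x y : gint) : x != 0 -> y != 0 -> x * y != 0.
Proof. by rewrite -!gnorm_eq0 gnormM mulf_eq0 => /negPf-> /negPf->. Qed.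

Lemma gint_prod_neq0 (I : Type) (s : seq I) (P : pred I) (f : I -> gint) :
  (forall i, P i -> f i != 0) -> \prod_(i <- s | P i) f i != 0.
Proof.
by move=> f0; elim/big_ind: _ => //; exact: gint_mulf_neq0.
Qed.

Lemma gdvdxx (x : gint) : gdvd x x.
Proof. by exists 1; rewrite mul1r. Qed.

Lemma gdvd0 (x : gint) : gdvd x 0.
Proof. by exists 0; rewrite mul0r. Qed.

Lemma gdvd_trans (x y z : gint) : gdvd x y -> gdvd y z -> gdvd x z.
Proof. by move=> [c ->] [e ->]; exists (e * c); rewrite mulrA. Qed.

Lemma gdvd_mull (x y z : gint) : gdvd x y -> gdvd x (z * y).
Proof. by move=> [c ->]; exists (z * c); rewrite mulrA. Qed.

Lemma gdvd_mulr (x y z : gint) : gdvd x y -> gdvd x (y * z).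
Proof. by rewrite mulrC; apply: gdvd_mull. Qed.

Lemma gdvdD (x y z : gint) : gdvd x y -> gdvd x z -> gdvd x (y + z).
Proof. by move=> [c ->] [e ->]; exists (c + e); rewrite mulrDl. Qed.

Lemma gdvdN (x y : gint) : gdvd x y -> gdvd x (- y).
Proof. by move=> [c ->]; exists (- c); rewrite mulNr. Qed.

Lemma gdvdB (x y z : gint) : gdvd x y -> gdvd x z -> gdvd x (y - z).
Proof. by move=> hy hz; apply: gdvdD => //; apply: gdvdN. Qed.

Lemma gdvd_prod (I : finType) (P : pred I) (f : I -> gint) (i : I) :
  P i -> gdvd (f i) (\prod_(j | P j) f j).
Proof. by move=> Pi; rewrite (bigD1 i) //=; apply/gdvd_mulr/gdvdxx. Qed.

(** * Euclidean division and Bezout relations *)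

Lemma divz_round (A n : int) : 0 < n -> exists c : int, 4 * (A - c * n) ^+ 2 <= n ^+ 2.
Proof.
(* This is the floor of [A / n + 1/2], an integer nearest to [A / n]. *)
move=> n0; exists ((2 * A + n) %/ (2 * n))%Z.
have h := divz_eq (2 * A + n) (2 * n).
have h0 : 0 <= ((2 * A + n) %% (2 * n))%Z by apply: modz_ge0; lia.
have h1 : ((2 * A + n) %% (2 * n))%Z < 2 * n by apply: ltz_pmod; lia.
move: h h0 h1; set c := (_ %/ _)%Z; set r := (_ %% _)%Z => h h0 h1.
have -> : 4 * (A - c * n) ^+ 2 = (r - n) ^+ 2.
  have -> : r = 2 * A + n - c * (2 * n) by rewrite h; ring.
  ring.
nia.
Qed.

(** Both coordinates of [x * gconj y / gnorm y] are rounded to a nearest integer; the error has norm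
    at most 1/2. *)
Lemma gint_euclid (x y : gint) : y != 0 ->
  exists q : gint, gnorm (x - q * y) < gnorm y.
Proof.
move=> y0; have ny : 0 < gnorm y by rewrite lt_def gnorm_eq0 y0 gnorm_ge0.
have [c hc] := divz_round (Re (x * gconj y)) _ ny.
have [e he] := divz_round (Im (x * gconj y)) _ ny.
pose q : gint := c +i* e; exists q; rewrite -(ltr_pM2r ny).
set N := gnorm y in hc he ny *.
have -> : gnorm (x - q * y) * N =
    (Re (x * gconj y) - c * N) ^+ 2 + (Im (x * gconj y) - e * N) ^+ 2.
  by rewrite /N /gnorm !gintE /=; ring.
nia.
Qed.

Lemma gint_bezout (x y : gint) :
  exists g u v : gint, [/\ gdvd g x, gdvd g y & g = u * x + v * y].
Proof.
have [n] := ubnP `|gnorm y|%N; elim: n x y => // n IHn x y ny.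
have [->|y0] := eqVneq y 0.
  exists x, 1, 0; split; [exact: gdvdxx|exact: gdvd0|].
  by rewrite mul1r mulr0 addr0.
have [q hq] := gint_euclid x y y0.
have hr : (`|gnorm (x - q * y)%R| < n)%N.
  by have := gnorm_ge0 (x - q * y); have := gnorm_ge0 y; lia.
have [g [u [v [gy gr ge]]]] := IHn y (x - q * y) hr.
exists g, v, (u - v * q); split=> //; last by rewrite ge; ring.
by rewrite -(subrK (q * y) x); apply: gdvdD => //; apply: gdvd_mull.
Qed.

(** * Coprimality in Bezout form and the Chinese remainder theorem *)

Definition comaximal (x y : gint) := exists u v : gint, u * x + v * y = 1.

Lemma gcoprime_comaximal (x y : gint) : gcoprime x y -> comaximal x y.
Proof.
move=> cop; have [g [u [v [gx gy ge]]]] := gint_bezout x y.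
have [c cE] := cop g gx gy.
by exists (c * u), (c * v); rewrite cE ge; ring.
Qed.

Lemma comaximal_sym (x y : gint) : comaximal x y -> comaximal y x.
Proof. by move=> [u [v h]]; exists v, u; rewrite addrC. Qed.

Lemma comaximal_mulr (x y z : gint) :
  comaximal x y -> comaximal x z -> comaximal x (y * z).
Proof.
move=> [u [v h]] [u' [v' h']].
exists (u * u' * x + u * v' * z + v * y * u'), (v * v').
by rewrite -[RHS]mulr1 -{1}h -h'; ring.
Qed.

Lemma comaximal_prod (I : Type) (s : seq I) (P : pred I) (x : gint)
    (f : I -> gint) :
  (forall i, P i -> comaximal x (f i)) -> comaximal x (\prod_(i <- s | P i) f i).
Proof.
move=> h; elim/big_ind: _ => //; last exact: comaximal_mulr.
by exists 0, 1; rewrite mul0r mul1r add0r.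
Qed.

Lemma comaximal_gconj (x y : gint) :
  comaximal x (gconj y) -> comaximal (gconj x) y.
Proof.
move=> [u [v h]]; exists (gconj u), (gconj v).
have cK (z : gint) : gconj (gconj z) = z by case: z => a b; rewrite /= opprK.
by rewrite -(cK y) -!gconjM -gconjD h.
Qed.

Lemma gdvd_comaximal (d x y : gint) : comaximal d x -> gdvd d (y * x) -> gdvd d y.
Proof.
move=> [u [v h]] dxy; rewrite -[y]mulr1 -h mulrDr; apply: gdvdD.
  by rewrite mulrA; apply/gdvd_mull/gdvdxx.
by rewrite mulrCA; apply: gdvd_mull.
Qed.

Lemma gint_chinese (I : eqType) (s : seq I) (f r : I -> gint) : uniq s ->
  (forall x y, x \in s -> y \in s -> x != y -> comaximal (f x) (f y)) ->
  exists a, forall x, x \in s -> gdvd (f x) (a - r x).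
Proof.
elim: s => [|x s IHs] /=; first by exists 0.
move=> /andP[xs us] cop.
have [|a ha] := IHs us.
  by move=> y z ys zs; apply: cop; rewrite inE ?ys ?zs orbT.
have : comaximal (f x) (\prod_(y <- s) f y).
  rewrite big_seq; apply: comaximal_prod => y ys.
  apply: cop; rewrite ?mem_head ?inE ?ys ?orbT //.
  by apply: contraNneq xs => ->.
move=> [u [v h]]; set P := \prod_(y <- s) f y in h.
(* [v * P] is 1 modulo [f x] and 0 modulo every modulus in the tail, so the correction fixes the
   residue at [x] and keeps the others. *)
exists (a + (r x - a) * (v * P)) => y; rewrite inE => /predU1P[->|ys].
  exists (- (r x - a) * u).
  have -> : v * P = 1 - u * f x by rewrite -h; ring.
  ring.
rewrite addrAC; apply: gdvdD; first exact: ha.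
apply/gdvd_mull/gdvd_mull; rewrite /P (big_rem y) //=.
exact/gdvd_mulr/gdvdxx.
Qed.

(** * Gaussian integers with coprime coordinates *)

Lemma coprimez_dvdz1 (m n : int) : coprimez m n = (gcdz m n %| 1%R)%Z.
Proof. by rewrite dvdz1. Qed.

Definition gprimitive (z : gint) := coprimez (Re z) (Im z).

(** A rational integer [g] dividing [x * y] also divides [x * y * gconj y], which is [x * gnorm y].
    Once [g] is known to be prime to [gnorm y], it divides [x] and is therefore a unit. *)
Lemma gprimitiveM (x y : gint) :
  comaximal y (gconj x) -> gprimitive x -> gprimitive y -> gprimitive (x * y).
Proof.
move=> /comaximal_gconj[u [v h]] px py.
set g := gcdz (Re (x * y)) (Im (x * y)).
have gr : (g %| Re (x * y))%Z := dvdz_gcdl _ _.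
have gi : (g %| Im (x * y))%Z := dvdz_gcdr _ _.
(* Multiplying [h] by [y] shows that a common divisor of [x * y] and
   [gnorm y] divides [y]. *)
have gN : coprimez g (gnorm y).
  have yE : y = u * (gnorm y)%:~R + v * (x * y).
    by rewrite -mul_gconj -[LHS]mulr1 -h; ring.
  rewrite coprimez_dvdz1; move: (eqP py) => <-; rewrite dvdz_gcd.
  set k := gcdz g _.
  have kg : (k %| g)%Z := dvdz_gcdl _ _.
  have kN : (k %| gnorm y)%Z := dvdz_gcdr _ _.
  have kr := dvdz_trans kg gr; have ki := dvdz_trans kg gi.
  move: kr ki; set z := x * y in yE * => kr ki; clearbody z.
  rewrite yE gint_intE !gintE /= !mulr0 subr0 add0r.
  by rewrite !(rpredD, rpredN) // ?dvdz_mull // ?dvdz_mulr.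
have xN : x * (gnorm y)%:~R = (x * y) * gconj y by rewrite -mul_gconj mulrA.
move: xN gr gi; rewrite /gprimitive coprimez_dvdz1 -/g gint_intE.
set z := x * y; clearbody z g => xN gr gi.
have := congr1 (@Re int) xN; have := congr1 (@Im int) xN.
rewrite !gintE /= !mulr0 subr0 add0r => xi xr.
rewrite -[X in (g %| X)%Z](eqP px) dvdz_gcd.
rewrite -(Gauss_dvdzl (Re x) gN) -(Gauss_dvdzl (Im x) gN) xr xi.
by rewrite !(rpredD, rpredN) ?dvdz_mulr // rpredN dvdz_mulr.
Qed.

Lemma gprimitive_prod (I : finType) (P : pred I) (f : I -> gint) :
  (forall i, P i -> gprimitive (f i)) ->
  (forall i j, i != j -> comaximal (f i) (gconj (f j))) ->
  gprimitive (\prod_(i | P i) f i).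
Proof.
move=> pf cop; rewrite -big_filter.
have : all P [seq i <- index_enum I | P i] by apply: filter_all.
have : uniq [seq i <- index_enum I | P i] by rewrite filter_uniq // index_enum_uniq.
elim: (filter _ _) => [|i s IHs] /=; first by rewrite big_nil.
move=> /andP[is_ us] /andP[Pi Ps]; rewrite big_cons; apply: gprimitiveM.
- apply: comaximal_sym.
  rewrite big_seq; apply: comaximal_prod => j js.
  apply/comaximal_sym/cop.
  by apply: contraNneq is_ => <-.
- exact: pf.
- exact: IHs.
Qed.

Lemma gdvd_gprimitive (q z : gint) : gdvd q z -> gprimitive z -> gprimitive q.
Proof.
move=> [c ->] /eqP pz; rewrite /gprimitive coprimez_dvdz1 -[X in (_ %| X)%Z]pz.
rewrite dvdz_gcd !gintE !(rpredD, rpredN) //=;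
  by rewrite dvdz_mull // (dvdz_gcdl, dvdz_gcdr).
Qed.

(** A nonzero [v] will allow the real part to grow along the kernel of the relation. If [v = 0],
    then [u * Re z = 1], and shifting the coefficients by [(Im z, - Re z)] makes the second one
    nonzero. *)
Lemma gprimitive_bezout (z : gint) : gprimitive z ->
  exists u v : int, u * Re z + v * Im z = 1 /\ v <> 0.
Proof.
move=> /eqP pz; have [u [v h]] := Bezoutz (Re z) (Im z); rewrite pz in h.
have [v0|/eqP v0] := eqVneq v 0; last by exists u, v.
exists (u + Im z), (v - Re z); split; first by rewrite -h; ring.
rewrite v0 sub0r => /eqP; rewrite oppr_eq0 => /eqP z0.
by move: h; rewrite v0 z0 mulr0 mul0r.
Qed.

(** * The line through [a] with direction [d] *)

Definition gline (R : realType) (a d : gint) : set R[i] :=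
  [set gint_to_complex R a + t%:C * gint_to_complex R d | t in [set: R]].
Arguments gline : clear implicits.

Section GaussianLine.
Variables (R : realType) (a d : gint) (u v : int).
Hypothesis ud : u * Re d + v * Im d = 1.

Lemma gint_to_complexD (t : R) (z : gint) :
  gint_to_complex R a + t%:C * gint_to_complex R z =
  ((Re a)%:~R + t * (Re z)%:~R) +i* ((Im a)%:~R + t * (Im z)%:~R).
Proof. by rewrite /gint_to_complex /=; simpc. Qed.

(** By [ud], the real parameter of [z] is an integer combination of the coordinates of [z - a],
    hence an integer. *)
Lemma gpoints_gline (z : gint) :
  gpoints (gline R a d) z <-> exists m : int, z = a + d *~ m.
Proof.
rewrite /gpoints /gline /=; split=> [[t _]|[m ->]]; last first.
  exists m%:~R => //; rewrite gint_to_complexD /gint_to_complex.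
  by rewrite !gintE Re_mulrz Im_mulrz !intrD !intrM !(mulrC m%:~R).
rewrite gint_to_complexD => -[hr hi].
pose m := u * (Re z - Re a) + v * (Im z - Im a); exists m.
have tE : t = m%:~R.
  have ud' : u%:~R * (Re d)%:~R + v%:~R * (Im d)%:~R = 1 :> R.
    by rewrite -!intrM -intrD ud.
  rewrite /m !(intrD, intrM) !intrN -hr -hi.
  by apply: etrans (_ : t * (u%:~R * (Re d)%:~R + v%:~R * (Im d)%:~R) = _);
    [rewrite ud' mulr1|ring].
clearbody m; have eqr : Re z = Re a + Re d * m.
  by apply: (@intr_inj R); rewrite -hr tE intrD intrM mulrC.
have eqi : Im z = Im a + Im d * m.
  by apply: (@intr_inj R); rewrite -hi tE intrD intrM mulrC.
by apply: gintP; rewrite gintE ?Re_mulrz ?Im_mulrz.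
Qed.

Hypothesis large : `|Re a| + gnorm a < Re d.

Let d0 : 0 < Re d.
Proof. by have := gnorm_ge0 a; have := normr_ge0 (Re a); lia. Qed.

Lemma gline_d_neq0 : gint_to_complex R d <> 0.
Proof.
move=> [/eqP]; rewrite intr_eq0 => /eqP h _.
by have := d0; rewrite h ltxx.
Qed.

(** By [large], the real part of [a + d *~ m] already exceeds [gnorm a] in absolute value, and the
    square of an integer is at least its absolute value. *)
Lemma gnorm_gline (m : int) : m != 0 -> gnorm a < gnorm (a + d *~ m).
Proof.
move=> m0; have na := gnorm_ge0 a.
rewrite {2}/Defs.gnorm !gintE Re_mulrz Im_mulrz.
have h : gnorm a < `|Re a + Re d * m|.
  have h1 : Re d <= `|Re d * m|.
    by rewrite normrM (gtr0_norm d0) ler_peMr //; [exact: ltW|lia].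
  by have := lerB_normD (Re d * m) (Re a); rewrite addrC; lia.
apply: (lt_le_trans h); rewrite -(real_normK (num_real (Re a + _))).
by have := sqr_ge0 (Im a + Im d * m); nia.
Qed.

Lemma base_point_gline : base_point (gline R a d) a.
Proof.
split; first by apply/gpoints_gline; exists 0; rewrite mulr0z addr0.
move=> z /gpoints_gline[m ->].
have [->|m0] := eqVneq m 0; first by rewrite mulr0z addr0.
by have := gnorm_gline m m0; split; lia.
Qed.

Lemma step_gline : step (gline R a d) a d.
Proof.
have pa : gpoints (gline R a d) a by case: base_point_gline.
have pad : gpoints (gline R a d) (a + d).
  by apply/gpoints_gline; exists 1.
right; split.
  move=> /(_ _ _ pa pad); rewrite /gint_to_complex /= => /intr_inj.
  by rewrite gintE; lia.
exists (a + d); split; last by rewrite addrC addKr.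
split=> //; first by rewrite gintE; lia.
move=> z /gpoints_gline[m ->]; rewrite gintE Re_mulrz => hm.
rewrite !(addrC a) !addrK -mulrzr gnormM ler_peMr ?gnorm_ge0 //.
by rewrite gint_intE /Defs.gnorm /=; nia.
Qed.

Lemma indexed_point_gline (m : int) :
  indexed_point (gline R a d) m (a + d *~ m).
Proof.
by exists a, d; split; [exact: base_point_gline|exact: step_gline|].
Qed.

Lemma primitive_gline : comaximal a d -> primitive_gaussian_line (gline R a d).
Proof.
move=> [x [y xy]].
have pa : gpoints (gline R a d) a by case: base_point_gline.
have pad : gpoints (gline R a d) (a + d).
  by apply/gpoints_gline; exists 1.
have neq : a <> a + d.
  by move=> /(congr1 (@Re int)); rewrite gintE; lia.
split; first split.
- exists (gint_to_complex R a), (gint_to_complex R d).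
  by split; first exact: gline_d_neq0.
- by exists a, (a + d).
exists a, (a + d); split=> // e ea ed; rewrite /gunit -xy.
apply: gdvdD; first exact: gdvd_mull.
by apply: gdvd_mull; rewrite -(addKr a d) addrC; apply: gdvdB.
Qed.

End GaussianLine.

(** The point [a + d] lies on the line of direction [d'], so [d] is a positive multiple of [d'].
    Applied both ways, equal lines force equal real parts of the directions. *)
Lemma gline_inj (R : realType) (a d d' : gint) (u v : int) :
  u * Re d' + v * Im d' = 1 -> 0 < Re d -> 0 < Re d' ->
  gline R a d = gline R a d' -> Re d' <= Re d.
Proof.
move=> ud d0 d'0 eL.
have : gpoints (gline R a d) (a + d).
  exists 1 => //; rewrite gint_to_complexD /gint_to_complex !gintE.
  by rewrite !intrD !mul1r.
rewrite eL => /(gpoints_gline _ _ _ _ _ ud)[m /addrI dE].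
move: d0; rewrite dE Re_mulrz pmulr_rgt0 // => m0.
by apply: ler_peMr; [exact: ltW|lia].
Qed.

(** * Residue conditions, choice of directions and the resulting family of lines *)

Definition gi : gint := 0 +i* 1.

(* Modulo [q] the points of the line are [(m + i) * P], and no rational
   integer greater than 1 divides [m + i]. *)
Lemma gprimitive_divisor (q P a d : gint) (m : int) :
  comaximal q P -> gdvd q (a - gi * P) -> gdvd q (d - P) ->
  gdvd q (a + d *~ m) -> gprimitive q.
Proof.
move=> qP qa qd qm.
have /(gdvd_comaximal _ _ _ qP) : gdvd q ((m%:~R + gi) * P).
  have -> : (m%:~R + gi) * P = (a + d *~ m) - (a - gi * P) - m%:~R * (d - P).
    by rewrite -(mulrzr d); ring.
  by apply: gdvdB; [apply: gdvdB|apply: gdvd_mull].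
by move/gdvd_gprimitive; apply; rewrite /gprimitive gint_intE !gintE /= add0r coprimezE coprimen1.
Qed.

Lemma gprimitive_nat (n : nat) : gprimitive n%:R -> n = 1%N.
Proof. by rewrite gint_natE /gprimitive /= coprimezE /= /coprime gcdn0 => /eqP. Qed.

Lemma gdvd_subr1_comaximal (x y : gint) : gdvd y (x - 1) -> comaximal x y.
Proof. by move=> [c xE]; exists 1, (- c); rewrite mulNr -xE; ring. Qed.

(* The directions [d n] are obtained from [P] by moving along the kernel of the
   Bezout relation [u * Re P + v * Im P = 1], which keeps them primitive. *)
Lemma large_directions (P : gint) (K B : int) : gprimitive P -> 0 < K ->
  exists (u v : int) (d : nat -> gint),
    [/\ forall n, u * Re (d n) + v * Im (d n) = 1,
        forall n, B < Re (d n),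
        forall n, gdvd K%:~R (d n - P) &
        injective (fun n => Re (d n))].
Proof.
move=> /gprimitive_bezout[u [v [uvP v0]]] K0.
(* The kernel vector [(v, - u)] is scaled by [v] so that its real part is positive whatever the sign
   of [v]. *)
pose e : gint := v ^+ 2 +i* (- (u * v)).
(* Large enough to outweigh a negative [Re P] and still exceed [B]. *)
pose N : int := `|Re P| + `|B| + 1.
exists u, v, (fun n : nat => P + e * (K * (N + n%:Z))%:~R).
have ReE (n : nat) : Re (P + e * (K * (N + n%:Z))%:~R) =
    Re P + v ^+ 2 * (K * (N + n%:Z)).
  by rewrite gint_intE !gintE /= mulr0 subr0.
have vK : 1 <= v ^+ 2 * K by have : 1 <= v ^+ 2; nia.
split=> [n|n|n|n n'].
- rewrite ReE gint_intE !gintE /= mulr0 add0r -uvP; ring.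
- rewrite ReE mulrA; have : N + n%:Z <= v ^+ 2 * K * (N + n%:Z).
    by rewrite ler_peMl // /N; lia.
  by rewrite /N; lia.
- by rewrite addrC addKr intrM mulrCA; apply/gdvd_mulr/gdvdxx.
move=> /=; rewrite !ReE !mulrA => /addrI/mulfI.
have -> : v ^+ 2 * K != 0 by lia.
by move=> /(_ isT)/addrI[].
Qed.

Theorem theorem4 (R : realType) (k t l : nat)
    (mu : 'I_k -> gint) (b : 'I_k -> int)
    (p : 'I_t -> nat) (ppi : 'I_l -> gint)
    (mu_neq0 : forall j, mu j <> 0)
    (p_prime : forall n, prime (p n))
    (p_mod4 : forall n, (p n = 3 %[mod 4])%N)
    (ppi_prime : forall m, gprime (ppi m))
    (ppi_nonrational : forall m, Im (ppi m) <> 0)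
    (pairwise_coprime : forall x y : 'I_k + 'I_t + 'I_l, x <> y ->
       gcoprime (join_family mu p ppi x) (join_family mu p ppi y))
    (ppi_nonconjugate : forall m m' : 'I_l, m <> m' ->
       gcoprime (ppi m) (conjc (ppi m'))) :
  infinite_set [set L : set R[i] |
    [/\ primitive_gaussian_line L,
        forall j, divisor_set L (mu j),
        (forall n, ~ divisor_set L (p n)%:R) /\
        (forall m, ~ divisor_set L (ppi m)) &
        forall j, exists z, indexed_point L (b j) z /\ gdvd (mu j) z]].
Proof.
pose f := join_family mu p ppi.
have fcop x y : x <> y -> comaximal (f x) (f y).
  by move=> /pairwise_coprime; apply: gcoprime_comaximal.
have f0 x : f x != 0.
  apply/eqP; case: x => [[j|n]|m] /=; first exact: mu_neq0.
    by rewrite gint_natE => -[pn0]; have := p_prime n; rewrite pn0.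
  by case: (ppi_prime m).
pose P : gint := \prod_(m | gprimitive (ppi m)) ppi m.
have primP : gprimitive P.
  apply: gprimitive_prod => // i j /eqP ij.
  exact/gcoprime_comaximal/ppi_nonconjugate.
have fP x : (forall m, x = inr m -> ~ gprimitive (ppi m)) -> comaximal (f x) P.
  move=> xP; apply: comaximal_prod => m pm.
  by apply: (fcop x (inr m)) => xm; apply: (xP m xm).
pose r (x : 'I_k + 'I_t + 'I_l) : gint := match x with
  | inl (inl j) => - (P *~ b j)
  | inl (inr n) => gi * P
  (* A nonrational prime without coprime coordinates is [i] or [-i] times a rational prime, such as
     [3i]; it is treated like the [p n]. *)
  | inr m => if gprimitive (ppi m) then 1 else gi * P
  end.
have [a [a0 ar]] : exists a, a != 0 /\ forall x, gdvd (f x) (a - r x).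
  have [||a ar] := gint_chinese _ (enum {: 'I_k + 'I_t + 'I_l}) f r.
  - exact: enum_uniq.
  - by move=> x y _ _ /eqP; apply: fcop.
  have {}ar x : gdvd (f x) (a - r x) by apply: ar; rewrite mem_enum.
  (* A nonzero [a] is needed for [K] to be positive. If 0 solves the congruences, so does the
     product of all the moduli. *)
  have [aE|a0] := eqVneq a 0; last by exists a.
  exists (\prod_x f x); split; first exact: gint_prod_neq0.
  move=> x; rewrite -[X in gdvd _ X]addr0 -aE addrAC -addrA.
  by apply: gdvdD; [apply: gdvd_prod|].
(* Taking the norm gives a positive rational integer that [a] and every [f x] divide. *)
pose K := gnorm (\prod_x f x * a).
have K0 : 0 < K.
  by rewrite lt_def gnorm_ge0 gnorm_eq0 gint_mulf_neq0 // gint_prod_neq0.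
have fK x : gdvd (f x) K%:~R.
  by rewrite -mul_gconj; apply/gdvd_mulr/gdvd_mulr/gdvd_prod.
have aK : gdvd a K%:~R.
  by rewrite -mul_gconj; apply/gdvd_mulr/gdvd_mull/gdvdxx.
have [u [v [d [ud dB dK dI]]]] := large_directions P K (`|Re a| + gnorm a) primP K0.
have fd x n : gdvd (f x) (d n - P) by apply: gdvd_trans (fK x) (dK n).
(* [a] is 1 modulo each factor of [P], hence comaximal with [P], and [d n] agrees with [P] modulo
   [a]. *)
have ad n : comaximal a (d n).
  have [c cE] := gdvd_trans _ _ _ aK (dK n).
  have [y [z yz]] : comaximal a P.
    apply: comaximal_prod => m pm; apply: gdvd_subr1_comaximal.
    by have := ar (inr m); rewrite /= pm.
  exists (y - z * c), z; rewrite -yz -[d n](subrK P) cE; ring.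
have mu_dvd j n : gdvd (mu j) (a + d n *~ b j).
  have -> : a + d n *~ b j = (a - r (inl (inl j))) + (b j)%:~R * (d n - P).
    by rewrite /= -(mulrzr P) -(mulrzr (d n)); ring.
  by apply: gdvdD; [exact: ar|apply/gdvd_mull/(fd (inl (inl j)))].
(* For the [p n] and the primes left out of [P], the conclusion is false, so they divide no point of
   the line. *)
have inertE x n m : (forall m, x = inr m -> ~ gprimitive (ppi m)) ->
    gdvd (f x) (a - gi * P) -> gdvd (f x) (a + d n *~ m) -> gprimitive (f x).
  by move=> xP xa; apply: gprimitive_divisor (fP x xP) xa (fd x n).
apply/(contra_not _ infinite_nat) => fin.
(* Every line of the sequence qualifies, so the preimage is all of [nat]; injectivity of the
   sequence, proved last, would make [nat] finite. *)
have := @finite_preimage nat _ _ (fun n => gline R a (d n)) _ fin.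
rewrite (_ : _ @^-1` _ = setT); last first.
  apply/seteqP; split=> // n _ /=.
  have ipt j := indexed_point_gline R a (d n) u v (ud n) (dB n) (b j).
  have gpt := gpoints_gline R a (d n) u v (ud n).
  split.
  - exact: (primitive_gline R a (d n) u v (ud n) (dB n)).
  - move=> j; exists (a + d n *~ b j); split; last exact: mu_dvd.
    by apply/gpt; exists (b j).
  - split=> [i|i] [z [/gpt[m ->]]].
      move=> /(inertE (inl (inr i)))-/(_ _ (ar (inl (inr i)))) h.
      have /gprimitive_nat pE : gprimitive (p i)%:R by apply: h.
      by have := p_prime i; rewrite pE.
    have := ar (inr i); rewrite /=; case: ifPn => [pi|/negP npi] qa qz.
      case: (ppi_prime i) => _ nu _; apply: nu.
      have qd : gdvd (ppi i) (d n).
        rewrite -[d n](subrK P); apply: gdvdD; first exact: (fd (inr i)).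
        exact: gdvd_prod.
      rewrite /gunit -[1](subKr a); apply: gdvdB => //.
      rewrite -(addrK (d n *~ m) a); apply: gdvdB => //.
      by rewrite -mulrzr; apply: gdvd_mulr.
    apply: (npi); apply: (inertE (inr i) n m _ qa qz) => _ [<-].
    exact: npi.
  - by move=> j; exists (a + d n *~ b j).
apply=> n n' _ _ eL; apply: dI.
have dpos i : 0 < Re (d i).
  by have := dB i; have := gnorm_ge0 a; have := normr_ge0 (Re a); lia.
apply: le_anti; apply/andP; split.
  exact: (gline_inj R a _ _ u v (ud n) (dpos n') (dpos n) (esym eL)).
exact: (gline_inj R a _ _ u v (ud n') (dpos n) (dpos n') eL).
Qed.
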